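(* Let $R$ be a Kähler algebraic curvature operator on a complex Euclidean vector space $(V,g,J)$ of complex dimension $m\geq1$, with scalar curvature $S$, and let $\{e_1,\dots,e_m,Je_1,\dots,Je_m\}$ be an orthonormal basis of $V$. Define $$\varphi^+_{ij}=\tfrac12\left(e_i\odot e_j-Je_i\odot Je_j\right),\qquad \psi^+_{ij}=\tfrac12\left(e_i\odot Je_j+Je_i\odot e_j\right)\qquad(1\leq i<j\leq m),$$ $$\theta_i=\tfrac{1}{2\sqrt2}\left(e_i\odot e_i-Je_i\odot Je_i\right),\qquad \theta_{m+i}=\tfrac{1}{\sqrt2}\,e_i\odot Je_i\qquad(1\leq i\leq m).$$ Then $$\mathring{R}(\varphi^+_{ij},\varphi^+_{ij})=\mathring{R}(\psi^+_{ij},\psi^+_{ij})=2R(e_i,Je_i,e_j,Je_j)$$ for $1\leq i<j\leq m$, and $$\mathring{R}(\theta_i,\theta_i)=\mathring{R}(\theta_{m+i},\theta_{m+i})=R(e_i,Je_i,e_i,Je_i)$$ for $1\leq i\leq m$. Moreover, $$\sum_{1\leq i<j\leq m}\left(\mathring{R}(\varphi^+_{ij},\varphi^+_{ij})+\mathring{R}(\psi^+_{ij},\psi^+_{ij})\right)+\sum_{i=1}^{2m}\mathring{R}(\theta_i,\theta_i)=S.$$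
   Context: A complex Euclidean vector space $(V,g,J)$ of complex dimension $m$ is a real inner product space $(V,g)$ of real dimension $2m$ with an endomorphism $J$ satisfying $J^2=-\operatorname{id}$ and $g(JX,JY)=g(X,Y)$. An algebraic curvature operator on $V$ is a 4-linear form $R$ on $V$ with $R(X,Y,Z,W)=-R(Y,X,Z,W)=-R(X,Y,W,Z)=R(Z,W,X,Y)$ and satisfying the first Bianchi identity $R(X,Y,Z,W)+R(Y,Z,X,W)+R(Z,X,Y,W)=0$. It is called Kähler if moreover $R(X,Y,Z,W)=R(X,Y,JZ,JW)$ for all $X,Y,Z,W\in V$. The sign convention is that $R(X,Y,X,Y)$ is the sectional curvature for orthonormal $X,Y$; the scalar curvature is $S=\sum_{a,b}R(E_a,E_b,E_a,E_b)$ for an orthonormal basis $\{E_a\}$ of $V$. $V$ is identified with $V^*$ via $g$, with $(e_i\otimes e_j)(e_k,e_l)=\delta_{ik}\delta_{jl}$ for an orthonormal basis, and $u\odot v=u\otimes v+v\otimes u$. The curvature operator of the second kind is the symmetric bilinear form on traceless symmetric two-tensors given in an orthonormal basis of $V$ by $\mathring{R}(\varphi,\psi)=\sum_{i,j,k,l}R_{ijkl}\varphi_{il}\psi_{jk}$. *)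

(* Defs.v *)
From HB Require Import structures.
From mathcomp Require Import all_boot all_order all_algebra reals.
From mathcomp Require Import ring.

Set Implicit Arguments.
Unset Strict Implicit.
Unset Printing Implicit Defensive.

Import Order.TTheory GRing.Theory Num.Theory.

Local Open Scope ring_scope.

Section Definitions.
Variables (K : realType) (V : vectType K).
(* [{dot V for idfun}]: symmetric positive definite bilinear forms on V. *)
Variable g : {dot V for idfun}.

Definition complex_euclidean (m : nat) (J : 'End(V)) : Prop :=
  [/\ \dim {:V} = (2 * m)%N,
      forall X, J (J X) = - X
    & forall X Y, g (J X) (J Y) = g X Y].

Record algebraic_curvature (R : V -> V -> V -> V -> K) : Prop :=
  AlgebraicCurvature {
    curv_linear1 : forall Y Z W, scalar (fun X => R X Y Z W);
    curv_linear2 : forall X Z W, scalar (fun Y => R X Y Z W);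
    curv_linear3 : forall X Y W, scalar (fun Z => R X Y Z W);
    curv_linear4 : forall X Y Z, scalar (fun W => R X Y Z W);
    curv_anti12 : forall X Y Z W, R X Y Z W = - R Y X Z W;
    curv_anti34 : forall X Y Z W, R X Y Z W = - R X Y W Z;
    curv_pair : forall X Y Z W, R X Y Z W = R Z W X Y;
    curv_bianchi : forall X Y Z W,
      R X Y Z W + R Y Z X W + R Z X Y W = 0
  }.

Definition kahler_curvature (J : 'End(V)) (R : V -> V -> V -> V -> K) : Prop :=
  algebraic_curvature R
  /\ forall X Y Z W, R X Y Z W = R X Y (J Z) (J W).

Definition orthonormal_basis (E : seq V) : Prop :=
  orthonormal g E /\ basis_of {:V} E.

(* The next two quantities do not depend on the orthonormal basis [E]; a
   statement using them quantifies over every orthonormal basis. *)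
Definition scalar_curvature (R : V -> V -> V -> V -> K) (E : seq V) : K :=
  \sum_(X <- E) \sum_(Y <- E) R X Y X Y.

(* With E = (E_1, ..., E_n) this is
   \sum_(i, j, k, l) R_ijkl phi_il psi_jk.  The formula makes sense for every
   pair of two-tensors; its domain of interest is the space of traceless
   symmetric ones, [sym2_0] below. *)
Definition curv2 (R : V -> V -> V -> V -> K) (E : seq V)
    (phi psi : V -> V -> K) : K :=
  \sum_(X <- E) \sum_(Y <- E) \sum_(Z <- E) \sum_(W <- E)
     R X Y Z W * phi X W * psi Y Z.

Record sym2_0 (E : seq V) (t : V -> V -> K) : Prop := Sym2_0 {
  sym2_0_linear : forall Y, scalar (fun X => t X Y);
  sym2_0_sym : forall X Y, t X Y = t Y X;
  sym2_0_trace : \sum_(X <- E) t X X = 0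
}.

(* Two-tensors are bilinear forms, vectors being identified with covectors
   through g. *)
Definition tens (u v : V) : V -> V -> K := fun X Y => g u X * g v Y.

Definition odot (u v : V) : V -> V -> K :=
  fun X Y => tens u v X Y + tens v u X Y.

Variables (J : 'End(V)) (m : nat) (e : 'I_m -> V).

Definition complex_frame : seq V :=
  [seq e i | i : 'I_m] ++ [seq J (e i) | i : 'I_m].

Definition phi_plus (i j : 'I_m) : V -> V -> K := fun X Y =>
  2^-1 * (odot (e i) (e j) X Y - odot (J (e i)) (J (e j)) X Y).

Definition psi_plus (i j : 'I_m) : V -> V -> K := fun X Y =>
  2^-1 * (odot (e i) (J (e j)) X Y + odot (J (e i)) (e j) X Y).

(* The index [lshift m i] stands for i and [rshift m i] for m + i. *)
Definition theta (k : 'I_(m + m)) : V -> V -> K := fun X Y =>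
  match split k with
  | inl i => (2 * Num.sqrt 2)^-1
               * (odot (e i) (e i) X Y - odot (J (e i)) (J (e i)) X Y)
  | inr i => (Num.sqrt 2)^-1 * odot (e i) (J (e i)) X Y
  end.

End Definitions.

Section TracelessSymmetric.
Variables (K : realType) (V : vectType K) (g : {dot V for idfun}).

Lemma dotC X Y : g X Y = g Y X.
Proof. by rewrite hermC expr0 mul1r. Qed.

Lemma dot_linearl Y : scalar (fun X => g X Y).
Proof. by move=> a X Z; rewrite linearDl linearZl_LR. Qed.

Lemma orthonormal_sum (E : seq V) u v : orthonormal g E -> u \in <<E>>%VS ->
  \sum_(X <- E) g u X * g v X = g u v.
Proof.
elim: E u v => [|x E IH] u v.
  by rewrite span_nil memv0 big_nil => _ /eqP ->; rewrite linear0l.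
rewrite /orthonormal /= !andbT => /andP[/andP[/eqP gx aE] /andP[/allP ox oE]].
rewrite span_cons => /memv_addP[_ /vlineP[a ->]] [w wE ->].
have oxE : {in E, forall X, g x X = 0} by move=> X /ox /eqP.
have gxw : g x w = 0.
  move: wE; rewrite -[E]in_tupleE => /coord_span ->.
  rewrite linear_sumr big1 // => i _.
  by rewrite linearZr_LR /= oxE ?mulr0 // mem_nth.
rewrite big_cons linearDl linearZl_LR /= gx [g w x]dotC gxw addr0 mulr1.
rewrite linearDl linearZl_LR /= [g x v]dotC; congr (_ + _).
rewrite -(IH w v) //; last by rewrite /orthonormal aE oE.
apply: eq_big_seq => X XE.
by rewrite linearDl linearZl_LR /= oxE // mulr0 add0r.
Qed.

Lemma trace_odot (E : seq V) u v : orthonormal_basis g E ->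
  \sum_(X <- E) odot g u v X X = 2 * g u v.
Proof.
case=> oE bE; rewrite /odot /tens big_split /= !orthonormal_sum //;
  try by rewrite (span_basis bE) memvf.
by rewrite [g v u]dotC mulr2n mulrDl mul1r.
Qed.

Lemma odot_linearl u v Y : scalar (fun X => odot g u v X Y).
Proof.
move=> a X Z; rewrite /odot /tens ![g _ (_ + _)]dotC !dot_linearl.
by rewrite ![g _ u]dotC ![g _ v]dotC /=; ring.
Qed.

Lemma odotC u v X Y : odot g u v X Y = odot g u v Y X.
Proof. by rewrite /odot /tens; ring. Qed.

Variables (m : nat) (J : 'End(V)) (e : 'I_m -> V) (E : seq V).
Hypothesis VgJ : complex_euclidean g m J.
Hypothesis ortho_e : orthonormal_basis g (complex_frame J e).
Hypothesis ortho_E : orthonormal_basis g E.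

Lemma complex_frame_eJe i j : g (e i) (J (e j)) = 0.
Proof.
case: ortho_e; rewrite /orthonormal /complex_frame => /andP[_ oe] _.
have Je : J (e j) \in [seq J (e i) | i : 'I_m].
  by apply/imageP; exists j.
have: e i \in [seq e i | i : 'I_m] by apply/imageP; exists i.
elim: [seq e i | i : 'I_m] oe => //= x s IH /andP[].
rewrite andbT => /allP ox /IH {}IH; rewrite inE => /predU1P[->|//].
by apply/eqP/(ox (J (e j))); rewrite mem_cat Je orbT.
Qed.

Lemma phi_plus_sym2_0 i j : sym2_0 E (phi_plus g J e i j).
Proof.
case: VgJ => _ _ gJ; split=> [Y a X Z|X Y|]; rewrite /phi_plus.
- by rewrite !odot_linearl; ring.
- by rewrite odotC [odot g (J _) _ _ _]odotC.
- by rewrite -mulr_sumr sumrB !trace_odot // gJ subrr mulr0.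
Qed.

Lemma psi_plus_sym2_0 i j : sym2_0 E (psi_plus g J e i j).
Proof.
split=> [Y a X Z|X Y|]; rewrite /psi_plus.
- by rewrite !odot_linearl; ring.
- by rewrite odotC [odot g (J _) _ _ _]odotC.
- rewrite -mulr_sumr big_split /= !trace_odot // [g (J _) _]dotC.
  by rewrite !complex_frame_eJe !mulr0 addr0 mulr0.
Qed.

Lemma theta_sym2_0 k : sym2_0 E (theta g J e k).
Proof.
case: VgJ => _ _ gJ; rewrite /theta; case: (split k) => i.
- split=> [Y a X Z|X Y|].
  + by rewrite !odot_linearl; ring.
  + by rewrite odotC [odot g (J _) _ _ _]odotC.
  + by rewrite -mulr_sumr sumrB !trace_odot // gJ subrr mulr0.
- split=> [Y a X Z|X Y|].
  + by rewrite !odot_linearl; ring.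
  + by rewrite odotC.
  + by rewrite -mulr_sumr trace_odot // complex_frame_eJe !mulr0.
Qed.

End TracelessSymmetric.

(* Main.v *)
(* By expanding vectors in E, [curv2] of u (x) v and x (x) y is R (u, x, y, v).  For
   arbitrary a, b, the J-invariance gives R (a, Jb, b, Ja) = R (a, Jb, a, Jb), and
   with the Bianchi identity R (a, Ja, b, Jb) = R (a, b, a, b) + R (a, Jb, a, Jb).
   This yields the values on phi_plus and psi_plus, also for i = j, where they
   are theta up to a factor sqrt 2.  Summing the same identity over all pairs
   i, j gives S. *)
Require Import Defs.
From HB Require Import structures.
From mathcomp Require Import all_boot all_order all_algebra reals.
From mathcomp Require Import ring lra.

Set Implicit Arguments.
Unset Strict Implicit.
Unset Printing Implicit Defensive.

Import Order.TTheory GRing.Theory Num.Theory.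

Local Open Scope ring_scope.

(** * Expansion in an orthonormal basis and basis independence of traces *)

Section OrthonormalBasis.
Variables (K : realType) (V : vectType K) (g : {dot V for idfun}) (E : seq V).
Hypothesis ortho_E : orthonormal_basis g E.

(** If the remainder [w] were nonzero, then [g w w > 0]; but expanding its left argument and
    applying Parseval ([orthonormal_sum]) to [g u w] gives [g w w = 0]. *)
Lemma orthonormal_expansion (u : V) : u = \sum_(X <- E) g u X *: X.
Proof.
case: ortho_E => oE bE.
apply/eqP; rewrite -subr_eq0; set w := u - _; apply: contraT => w_neq0.
have := neq0_dnorm_gt0 (s := g) w w_neq0.
rewrite {1}/w linearBl linear_sumlz /=.
rewrite -[X in X - _](orthonormal_sum w oE) ?(span_basis bE) ?memvf //.
under [X in _ - X]eq_bigr do rewrite linearZl_LR /= [g _ w]dotC.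
by rewrite subrr ltxx.
Qed.

Lemma scalar_expansion (f : V -> K) (u : V) :
  scalar f -> \sum_(X <- E) f X * g u X = f u.
Proof.
move=> lin_f.
(* Linearity of [f] is only a proposition; bundling it makes [linear_sum] applicable. *)
pose F : {scalar V} := HB.pack f (GRing.isLinear.Build _ _ _ _ f lin_f).
rewrite [in RHS](orthonormal_expansion u) -[f]/(F : V -> K) linear_sum.
by apply: eq_bigr => X _; rewrite linearZ /= mulrC.
Qed.

End OrthonormalBasis.

(** Expanding the first slot in [E] gives the double sum of [h Y X * g X Y] over [Y] in [E] and [X]
    in [F]; summing over [X] first collapses it to [h Y Y]. *)
Lemma trace_basis_independent (K : realType) (V : vectType K)
    (g : {dot V for idfun}) (E F : seq V) (h : V -> V -> K) :
  orthonormal_basis g E -> orthonormal_basis g F ->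
  (forall Y, scalar (h^~ Y)) -> (forall X, scalar (h X)) ->
  \sum_(X <- F) h X X = \sum_(X <- E) h X X.
Proof.
move=> ortho_E ortho_F linl linr.
under eq_bigr do rewrite -(scalar_expansion ortho_E _ (linl _)).
rewrite exchange_big; apply: eq_bigr => Y _.
under eq_bigr do rewrite dotC.
exact: scalar_expansion.
Qed.

(** * The curvature operator of the second kind on symmetric products *)

Section Curvature.
Variables (K : realType) (V : vectType K) (g : {dot V for idfun}) (E : seq V).
Variable R : V -> V -> V -> V -> K.

(** Tensors are functions, so this replaces them by pointwise equal ones without functional
    extensionality. *)
Lemma eq_curv2 (p p' q q' : V -> V -> K) :
  p =2 p' -> q =2 q' -> curv2 R E p q = curv2 R E p' q'.
Proof.
move=> pp' qq'; rewrite /curv2.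
by do 4!apply: eq_bigr => ? _; rewrite pp' qq'.
Qed.

Lemma curv2_linearl (a : K) (p q t : V -> V -> K) :
  curv2 R E (fun X Y => a * p X Y + q X Y) t
  = a * curv2 R E p t + curv2 R E q t.
Proof.
rewrite /curv2; do 4!(rewrite mulr_sumr -big_split /=; apply: eq_bigr => ? _).
ring.
Qed.

Lemma curv2_linearr (a : K) (p q t : V -> V -> K) :
  curv2 R E t (fun X Y => a * p X Y + q X Y)
  = a * curv2 R E t p + curv2 R E t q.
Proof.
rewrite /curv2; do 4!(rewrite mulr_sumr -big_split /=; apply: eq_bigr => ? _).
ring.
Qed.

Lemma curv2_scale (a : K) (p : V -> V -> K) :
  curv2 R E (fun X Y => a * p X Y) (fun X Y => a * p X Y)
  = a ^+ 2 * curv2 R E p p.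
Proof.
rewrite /curv2; do 4!(rewrite mulr_sumr; apply: eq_bigr => ? _).
ring.
Qed.

Hypothesis curvR : algebraic_curvature R.
Hypothesis ortho_E : orthonormal_basis g E.

Lemma curv2_tens (u v x y : V) :
  curv2 R E (tens g u v) (tens g x y) = R u x y v.
Proof.
rewrite /curv2 /tens -(scalar_expansion ortho_E u (curv_linear1 curvR x y v)).
apply: eq_bigr => X _.
rewrite -(scalar_expansion ortho_E x (curv_linear2 curvR X y v)) mulr_suml.
apply: eq_bigr => Y _.
rewrite -(scalar_expansion ortho_E y (curv_linear3 curvR X Y v)) !mulr_suml.
apply: eq_bigr => Z _.
rewrite -(scalar_expansion ortho_E v (curv_linear4 curvR X Y Z)) !mulr_suml.
by apply: eq_bigr => W _; ring.
Qed.

Lemma curv2_odot (u v x y : V) :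
  curv2 R E (odot g u v) (odot g x y)
  = R u x y v + R u y x v + R v x y u + R v y x u.
Proof.
(* The factor 1 puts [odot] in the shape [a * p + q] of the linearity lemmas. *)
pose t u v X Y := 1 * tens g u v X Y + tens g v u X Y.
have odotE u' v' : odot g u' v' =2 t u' v' by move=> X Y; rewrite /t mul1r.
rewrite (eq_curv2 (odotE u v) (odotE x y)) curv2_linearl !curv2_linearr.
by rewrite !curv2_tens; ring.
Qed.

(** A common expansion for both families: [phi_plus] is the case [b = -1] and [psi_plus] the case
    [b = 1], each with [a = 2^-1]. *)
Lemma curv2_odot_comb (a b : K) (u v x y : V) :
  let t X Y := a * (odot g u v X Y + b * odot g x y X Y) in
  curv2 R E t t = a ^+ 2 * (
    (R u u v v + R u v u v + R v u v u + R v v u u)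
    + b * (R u x y v + R u y x v + R v x y u + R v y x u)
    + b * (R x u v y + R x v u y + R y u v x + R y v u x)
    + b ^+ 2 * (R x x y y + R x y x y + R y x y x + R y y x x)).
Proof.
move=> t; pose s X Y := b * odot g x y X Y + odot g u v X Y.
have ts : t =2 (fun X Y => a * s X Y) by move=> X Y; rewrite /t /s addrC.
rewrite (eq_curv2 ts ts) curv2_scale; congr (_ * _).
rewrite /s curv2_linearl !curv2_linearr !curv2_odot.
ring.
Qed.

Lemma curv_diag12 (X Z W : V) : R X X Z W = 0.
Proof. have := curv_anti12 curvR X X Z W; lra. Qed.

Lemma curv_swap (X Y Z W : V) : R X Y Z W = R Y X W Z.
Proof. by rewrite (curv_anti12 curvR) (curv_anti34 curvR) opprK. Qed.

Lemma curvNr (X Y Z W : V) : R X Y Z (- W) = - R X Y Z W.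
Proof.
have := curv_linear4 curvR X Y Z (-1) W 0.
rewrite scaleN1r addr0 /=.
(* This instance yields [R X Y Z 0 = 0], which removes the extra term of the previous one. *)
have := curv_linear4 curvR X Y Z (-1) 0 0.
rewrite scaler0 addr0 /=; lra.
Qed.

Lemma scalar_curvature_basis_independent (F : seq V) :
  orthonormal_basis g F -> scalar_curvature R F = scalar_curvature R E.
Proof.
move=> ortho_F; rewrite /scalar_curvature.
(* [h G] is the Ricci form computed in [G]. The outer trace is moved from [F] to [E] first, then the
   inner one for each fixed [X]. *)
pose h (G : seq V) X X' := \sum_(Y <- G) R X Y X' Y.
rewrite (@trace_basis_independent _ _ g E F (h F)) //.
- apply: eq_bigr => X _.
  apply: (trace_basis_independent (h := fun Y Y' => R X Y X Y') ortho_E) => // Y.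
    exact: (curv_linear2 curvR).
  exact: (curv_linear4 curvR).
- move=> Y a X X'; rewrite /h mulr_sumr -big_split /=.
  by apply: eq_bigr => Z _; rewrite (curv_linear1 curvR).
- move=> Y a X X'; rewrite /h mulr_sumr -big_split /=.
  by apply: eq_bigr => Z _; rewrite (curv_linear3 curvR).
Qed.

End Curvature.

Lemma sum_symmetric (A : zmodType) (m : nat) (B : 'I_m -> 'I_m -> A) :
  (forall i j, B i j = B j i) ->
  \sum_i \sum_j B i j
  = (\sum_(i < m) \sum_(j < m | (i < j)%N) B i j) *+ 2 + \sum_i B i i.
Proof.
move=> symB.
have -> : \sum_i \sum_j B i j =
    \sum_(i < m) (\sum_(j < m | (i < j)%N) B i j + \sum_(j < m | (j < i)%N) B i j
           + B i i).
  apply: eq_bigr => i _; rewrite (bigD1 i) //= addrC; congr (_ + _).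
  rewrite (bigID (fun j : 'I_m => (i < j)%N)) /=; congr (_ + _).
    by apply: eq_bigl => j; rewrite -val_eqE /=; case: ltngtP.
  by apply: eq_bigl => j; rewrite -val_eqE /=; case: ltngtP.
rewrite !big_split /= mulr2n; congr (_ + _ + _).
(* Exchanging the indices turns the part below the diagonal into the part above it. *)
rewrite (exchange_big_dep xpredT) //=.
by apply: eq_bigr => i _; apply: eq_bigr => j _; apply: symB.
Qed.

(** * Kähler identities and the values on the given tensors *)

Section Kahler.
Variables (K : realType) (V : vectType K) (g : {dot V for idfun}) (m : nat).
Variables (J : 'End(V)) (R : V -> V -> V -> V -> K) (E : seq V).
Hypothesis VgJ : complex_euclidean g m J.
Hypothesis kahlerR : kahler_curvature J R.
Hypothesis ortho_E : orthonormal_basis g E.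

Let curvR : algebraic_curvature R := proj1 kahlerR.

Lemma kahler34 (X Y Z W : V) : R X Y (J Z) (J W) = R X Y Z W.
Proof. by rewrite -(proj2 kahlerR). Qed.

Lemma kahler12 (X Y Z W : V) : R (J X) (J Y) Z W = R X Y Z W.
Proof. by rewrite (curv_pair curvR) kahler34 -(curv_pair curvR). Qed.

Lemma kahler_JR (X Y Z W : V) : R X Y Z (J W) = - R X Y (J Z) W.
Proof.
by case: VgJ => _ JJ _; rewrite -kahler34 JJ (curvNr curvR).
Qed.

(** Moving one [J] within the last pair turns both sides into [- R (J a) b a (J b)], up to pair
    symmetry. *)
Lemma kahler_swapJ (a b : V) : R (J a) b (J a) b = R a (J b) a (J b).
Proof.
have := kahler_JR (J a) b a b; have := kahler_JR a (J b) a b.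
rewrite (curv_pair curvR a (J b) (J a)); lra.
Qed.

(** The left side is the holomorphic bisectional curvature; the other two terms of its Bianchi sum
    are the negatives of the terms on the right. *)
Lemma kahler_bisectional (a b : V) :
  R a (J a) b (J b) = R a b a b + R a (J b) a (J b).
Proof.
have := curv_bianchi curvR a (J a) b (J b).
have -> : R b a (J a) (J b) = - R a b a b.
  by rewrite kahler34 (curv_anti12 curvR).
have -> : R (J a) b a (J b) = - R a (J b) a (J b).
  by rewrite kahler_JR kahler_swapJ.
lra.
Qed.

Lemma curv2_phi_plus (e : 'I_m -> V) (i j : 'I_m) :
  curv2 R E (phi_plus g J e i j) (phi_plus g J e i j)
  = 2 * R (e i) (J (e i)) (e j) (J (e j)).
Proof.
set a := e i; set b := e j.
pose t X Y := 2^-1 * (odot g a b X Y + (-1) * odot g (J a) (J b) X Y).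
have tE : phi_plus g J e i j =2 t by move=> X Y; rewrite /t mulN1r.
rewrite (eq_curv2 E R tE tE) (curv2_odot_comb curvR ortho_E).
(* Write [B], [P], [Q] for [R a (J a) b (J b)], [R a b a b], [R a (J b) a (J b)]. Four of the
   sixteen terms vanish and the others, with their signs, give [4 P + 4 B + 4 Q]; after the factor
   1/4, the identity [B = P + Q] leaves [2 B]. *)
rewrite !(curv_diag12 curvR) !kahler12 !kahler34.
rewrite (curv_anti34 curvR a (J a) (J b)) (curv_anti34 curvR b (J b) (J a)).
rewrite (curv_anti12 curvR (J a) a) (curv_anti12 curvR (J b) b).
rewrite (curv_pair curvR b (J b) a) (curv_swap curvR b a).
rewrite (curv_swap curvR b (J a)) (curv_swap curvR (J b) a) (curv_pair curvR (J a) b a).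
have -> : R a (J b) (J a) b = - R a (J b) a (J b) by rewrite kahler_JR opprK.
by rewrite !kahler_bisectional; field.
Qed.

Lemma curv2_psi_plus (e : 'I_m -> V) (i j : 'I_m) :
  curv2 R E (psi_plus g J e i j) (psi_plus g J e i j)
  = 2 * R (e i) (J (e i)) (e j) (J (e j)).
Proof.
set a := e i; set b := e j.
pose t X Y := 2^-1 * (odot g a (J b) X Y + 1 * odot g (J a) b X Y).
have tE : psi_plus g J e i j =2 t by move=> X Y; rewrite /t mul1r.
rewrite (eq_curv2 E R tE tE) (curv2_odot_comb curvR ortho_E).
(* The total is again [4 P + 4 B + 4 Q], but now [Q] comes from the two squares and [P], [B] from
   the cross terms. *)
rewrite !(curv_diag12 curvR) !kahler12 !kahler34 !kahler_swapJ.
rewrite (curv_swap curvR b (J a)).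
rewrite (curv_swap curvR (J b) b) (curv_swap curvR (J a) a).
rewrite kahler_swapJ (curv_swap curvR b a) (curv_pair curvR b (J b)).
by rewrite !kahler_bisectional; field.
Qed.

Lemma theta_lshift (e : 'I_m -> V) (i : 'I_m) :
  theta g J e (lshift m i)
  =2 (fun X Y => (Num.sqrt 2)^-1 * phi_plus g J e i i X Y).
Proof.
(* [lshift m i] is [unsplit (inl i)] by computation, so [unsplitK] resolves the [split] in
   [theta]. *)
move=> X Y; rewrite /theta (unsplitK (inl i)) /phi_plus invfM; ring.
Qed.

Lemma theta_rshift (e : 'I_m -> V) (i : 'I_m) :
  theta g J e (rshift m i)
  =2 (fun X Y => (Num.sqrt 2)^-1 * psi_plus g J e i i X Y).
Proof.
move=> X Y; rewrite /theta (unsplitK (inr i)) /psi_plus; congr (_ * _).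
(* For equal indices the two summands of [psi_plus] coincide, which absorbs its factor 1/2. *)
have -> : odot g (J (e i)) (e i) X Y = odot g (e i) (J (e i)) X Y.
  by rewrite /odot addrC.
by field.
Qed.

Lemma curv2_theta_lshift (e : 'I_m -> V) (i : 'I_m) :
  curv2 R E (theta g J e (lshift m i)) (theta g J e (lshift m i))
  = R (e i) (J (e i)) (e i) (J (e i)).
Proof.
rewrite (eq_curv2 E R (theta_lshift e i) (theta_lshift e i)) curv2_scale.
(* The squared scale [(Num.sqrt 2)^-1 ^+ 2] is 1/2 and cancels the 2 in the value on [phi_plus]. *)
by rewrite curv2_phi_plus exprVn sqr_sqrtr // mulKf ?pnatr_eq0.
Qed.

Lemma curv2_theta_rshift (e : 'I_m -> V) (i : 'I_m) :
  curv2 R E (theta g J e (rshift m i)) (theta g J e (rshift m i))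
  = R (e i) (J (e i)) (e i) (J (e i)).
Proof.
rewrite (eq_curv2 E R (theta_rshift e i) (theta_rshift e i)) curv2_scale.
by rewrite curv2_psi_plus exprVn sqr_sqrtr // mulKf ?pnatr_eq0.
Qed.

(** For each [i], [j], the blocks without [J] and with two [J] both give
    [R (e i) (e j) (e i) (e j)], and the two mixed blocks both give
    [R (e i) (J (e j)) (e i) (J (e j))]; together they make twice the bisectional curvature. *)
Lemma scalar_curvature_complex_frame (e : 'I_m -> V) :
  scalar_curvature R (complex_frame J e)
  = 2 * \sum_i \sum_j R (e i) (J (e i)) (e j) (J (e j)).
Proof.
rewrite /scalar_curvature /complex_frame big_cat /= !big_image /=.
rewrite -big_split mulr_sumr /=; apply: eq_bigr => i _.
rewrite !big_cat !big_image /= -!big_split mulr_sumr /=; apply: eq_bigr => j _.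
rewrite kahler_bisectional.
have -> : R (J (e i)) (J (e j)) (J (e i)) (J (e j)) = R (e i) (e j) (e i) (e j).
  by rewrite kahler12 kahler34.
rewrite kahler_swapJ.
ring.
Qed.

End Kahler.

Theorem lemma4p3 (K : realType) (m : nat) (V : vectType K)
    (g : {dot V for idfun}) (J : 'End(V)) (R : V -> V -> V -> V -> K)
    (e : 'I_m -> V) (E : seq V)
    (m_ge1 : (1 <= m)%N)
    (VgJ : complex_euclidean g m J)
    (kahlerR : kahler_curvature J R)
    (ortho_e : orthonormal_basis g (complex_frame J e))
    (ortho_E : orthonormal_basis g E) :
  [/\ forall i j : 'I_m, (i < j)%N ->
        curv2 R E (phi_plus g J e i j) (phi_plus g J e i j)
          = 2 * R (e i) (J (e i)) (e j) (J (e j))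
        /\ curv2 R E (psi_plus g J e i j) (psi_plus g J e i j)
          = 2 * R (e i) (J (e i)) (e j) (J (e j)),
      forall i : 'I_m,
        curv2 R E (theta g J e (lshift m i)) (theta g J e (lshift m i))
          = R (e i) (J (e i)) (e i) (J (e i))
        /\ curv2 R E (theta g J e (rshift m i)) (theta g J e (rshift m i))
          = R (e i) (J (e i)) (e i) (J (e i))
    & \sum_(i < m) \sum_(j < m | (i < j)%N)
          (curv2 R E (phi_plus g J e i j) (phi_plus g J e i j)
           + curv2 R E (psi_plus g J e i j) (psi_plus g J e i j))
        + \sum_(k < m + m) curv2 R E (theta g J e k) (theta g J e k)
      = scalar_curvature R E].
Proof.
split=> [i j _|i|].
- by split; [exact: curv2_phi_plus VgJ kahlerR ortho_E _ _ _
            |exact: curv2_psi_plus VgJ kahlerR ortho_E _ _ _].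
- by split; [exact: curv2_theta_lshift VgJ kahlerR ortho_E _ _
            |exact: curv2_theta_rshift VgJ kahlerR ortho_E _ _].
have [curvR _] := kahlerR.
rewrite -(scalar_curvature_basis_independent curvR ortho_E ortho_e).
rewrite (scalar_curvature_complex_frame VgJ kahlerR).
(* The scalar curvature becomes four times the sum over [i < j] plus twice the diagonal. On the
   other side each pair [i < j] contributes [2 + 2] through [phi_plus] and [psi_plus], and each [i]
   contributes [1 + 1] through the two [theta]. *)
rewrite (sum_symmetric (B := fun i j => R (e i) (J (e i)) (e j) (J (e j))));
  last by move=> i j; rewrite (curv_pair curvR).
rewrite big_split_ord /=.
under [X in _ + (X + _)]eq_bigr do
  rewrite (curv2_theta_lshift VgJ kahlerR ortho_E).
under [X in _ + (_ + X)]eq_bigr do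
  rewrite (curv2_theta_rshift VgJ kahlerR ortho_E).
under eq_bigr do under eq_bigr do
  rewrite (curv2_phi_plus VgJ kahlerR ortho_E)
          (curv2_psi_plus VgJ kahlerR ortho_E) -mulrDr -mulr2n.
under eq_bigr do rewrite -mulr_sumr sumrMnl.
rewrite -mulr_sumr sumrMnl; ring.
Qed.
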